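(* Consider $A=M_2(\mathbb{C})$ with its standard 2D calculus, the quantum metric $g=\imath(s^2\otimes s^1-s^1\otimes s^2)$ and the 1-parameter family of quantum Levi-Civita connections $\nabla s^i=2\vartheta\otimes s^i-\mu\sum_k\epsilon_{ik}\sigma^is^i\otimes s^k$, $\mu\in\mathbb{R}$. Let $$C^1=\begin{pmatrix}c_1&c_2\\ \frac{c_0-c_1^2}{c_2}&-c_1\end{pmatrix},\qquad C^2=\begin{pmatrix}c_3&c_4\\ \frac{c_0-c_3^2}{c_4}&-c_3\end{pmatrix},\qquad c_0,\dots,c_4\in\mathbb{C},\ c_2,c_4\neq0,$$ be generic in the sense that $[C^1,C^2]$ is invertible, and let $J\in M_2(\mathbb{C})$ be any matrix with $\overline JJ=\epsilon\,\mathrm{id}$, $\epsilon=\pm1$. Then one can solve all of the following remaining local tensorial level conditions for a fully geometrically realised spectral triple of inner type: (a) $\sum_j\overline{S_j}\,J\,\sigma_{\mathcal S}{}^j{}_i=JS_i$; (b) $\overline{C^i}J=\epsilon'\sum_jJ\,\sigma_{\mathcal S}{}^i{}_jC^j$; (c) $C^iS_j-\sum_{k,l}\sigma^{ik}{}_{jl}S_kC^l=-\frac12\sum_k\Gamma^i{}_{jk}C^k$, if and only if $\mu=0$. In this case, solutions have the form $$\sigma_{\mathcal S}{}^i{}_j=\zeta^i{}_j\,[C^1,C^2],\qquad \overline{C^i}=\epsilon'\sum_j\zeta^i{}_j\,J[C^1,C^2]C^jJ^{-1}$$ for any invertible matrix $\zeta=(\zeta^i{}_j)\in M_2(\mathbb{C})$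 obeying $$\overline\zeta\,\zeta=\mathrm{id},\qquad \det(\zeta)=-\frac{1}{\det([C^1,C^2])^2}.$$ Moreover, a canonical $\gamma$ obeying its local conditions ($\gamma^2=\mathrm{id}$, $\{C^i,\gamma\}=0$, $\overline\gamma J=\epsilon''J\gamma$, $[S_i,\gamma]=0$) has the form $$\gamma=\frac{[C^1,C^2]}{\sqrt{-\det([C^1,C^2])}},\qquad \overline\gamma=\epsilon''J\gamma J^{-1}.$$ These solutions are subject to the $C^i$ and $\gamma$ satisfying the stated reality conditions (the displayed formulas for $\overline{C^i}$ and $\overline\gamma$) for some signs $\epsilon',\epsilon''\in\{\pm1\}$.
   Context: **Calculus.** $\Omega^1(M_2(\mathbb{C}))$ is free with central self-adjoint basis $s^1,s^2$. With Pauli matrices $\sigma^1=\begin{pmatrix}0&1\\1&0\end{pmatrix}$, $\sigma^2=\begin{pmatrix}0&-\imath\\\imath&0\end{pmatrix}$, $\sigma^3=\begin{pmatrix}1&0\\0&-1\end{pmatrix}$ as elements of $A$, it is inner with $da=[\vartheta,a]$, $\vartheta=\frac{\imath}{2}(\sigma^1s^1+\sigma^2s^2)$, so $da=(\partial_ia)s^i$ with $\partial_i=\frac{\imath}{2}[\sigma^i,\ ]$, $i=1,2$. $\epsilon_{ij}$ is antisymmetric with $\epsilon_{12}=1$. **Connection on $\Omega^1$.** A bimodule connection obeys $\nabla(a\omega)=a\nabla\omega+da\otimes\omega$, $\nabla(\omega a)=(\nabla\omega)a+\sigma(\omega\otimes da)$. For the stated family the braiding is $\sigma(s^i\otimes s^j)=-s^j\otimes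 s^i-2\imath\mu\,\delta_{ij}\sum_k\epsilon_{ik}s^i\otimes s^k$. The coefficients are defined by $\sigma(s^i\otimes s^j)=\sigma^{ij}{}_{kl}s^k\otimes s^l$ and $\nabla s^i=-\frac12\Gamma^i{}_{jk}s^j\otimes s^k$, with $\Gamma^i{}_{jk}\in A$. **Spinor data.** $\mathcal S$ is a free $A$-bimodule with central basis $e^1,e^2$. The Clifford action is $s^i\triangleright e^\alpha=C^{i\alpha}{}_\beta e^\beta$, $C^{i\alpha}{}_\beta\in\mathbb{C}$. Charge conjugation is $\mathcal J(ae^\alpha)=a^*J^\alpha{}_\beta e^\beta$. The even structure is $\gamma(e^\alpha)=\gamma^\alpha{}_\beta e^\beta$ with $\gamma^\alpha{}_\beta\in\mathbb{C}$. The bimodule connection is $\nabla_{\mathcal S}e^\alpha=S^\alpha{}_{i\beta}s^i\otimes e^\beta$ ($S^\alpha{}_{i\beta}\in A$) with generalised braiding $\sigma_{\mathcal S}(e^\alpha\otimes s^j)=\sigma_{\mathcal S}{}^{\alpha j}{}_{i\beta}s^i\otimes e^\beta$, coefficients in $\mathbb{C}$. Everything is written as matrices in spinor indices (row $\alpha$, column $\beta$): $(\sigma_{\mathcal S}{}^j{}_i)^\alpha{}_\beta=\sigma_{\mathcal S}{}^{\alpha j}{}_{i\beta}$, $(S_i)^\alpha{}_\beta=S^\alpha{}_{i\beta}$, with products being matrix products in spinor indices. Overline denotes entrywise complex conjugation, or entrywise $*$ in $A$ when the entries are in $A$ (so $\overline{S_j}$ has entries $S^\alpha{}_{j\beta}{}^*$).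 ''Inner type'' means that $\nabla_{\mathcal S}$ is determined by $\sigma_{\mathcal S}$ via $\nabla_{\mathcal S}=\vartheta\otimes(\ )-\sigma_{\mathcal S}((\ )\otimes\vartheta)$, i.e. $S_i=\frac{\imath}{2}\big(\sigma^i\,\mathrm{id}-\sum_j\sigma^j\,\sigma_{\mathcal S}{}^j{}_i\big)$, where $\sigma^i,\sigma^j$ are elements of $A$ and the other factors are matrices in spinor indices. The given $C^i$ are the generic pairs of traceless matrices with equal determinant $-c_0$, so $(C^1)^2=(C^2)^2$.
   Formalization: Not every solution has ζ̄ζ=id: the formal theorem characterises all solutions by ζ̄ζ = -1/(det([C¹,C²])² det ζ)·id; for invertible ζ with ζ̄ζ=id it proves that one has a solution iff det ζ = -1/det([C¹,C²])² and the reality formula holds. *)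

(* Defs.v *)
From mathcomp Require Import all_boot all_order all_algebra.
From mathcomp Require Import complex.
From mathcomp Require Import reals.

Set Implicit Arguments.
Unset Strict Implicit.
Unset Printing Implicit Defensive.

Import Order.TTheory GRing.Theory Num.Theory.
Local Open Scope ring_scope.

(* All indices 1, 2 of the text are shifted to 0, 1 : 'I_2. *)

Definition mx2 (T : Type) (a b c d : T) : 'M[T]_2 :=
  \matrix_(i, j) if i == 0 then (if j == 0 then a else b)
                 else (if j == 0 then c else d).

Section Calculus.
Variable R : realType.

Local Notation C := R[i].
Local Notation A := 'M[C]_2.

Definition is_sign (e : C) : Prop := e = 1 \/ e = -1.

Definition star (a : A) : A := map_mx Num.conj a^T.

Definition pauli (i : 'I_2) : A :=
  if i == 0 then mx2 0 1 1 0 else mx2 0 (- 'i) 'i 0.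

Definition epsilon (i k : 'I_2) : C :=
  if i == k then 0 else if i == 0 then 1 else -1.

(* A 1-form w_j s^j is the row vector of its coefficients w_j in A, and an
   element t_jk s^j (x) s^k of the tensor square over A is the matrix (t_jk).
   Coefficients stand on the left; as the s^j are central,
   (w_j s^j) (x) (v_k s^k) has coefficients w_j v_k. *)
Definition frame (i : 'I_2) : 'rV[A]_2 := delta_mx 0 i.

Definition tens (w v : 'rV[A]_2) : 'M[A]_2 := w^T *m v.

Definition theta : 'rV[A]_2 := \row_i (('i / 2) *: pauli i).

(* The values nabla (s^i). *)
Definition nabla (mu : R) (i : 'I_2) : 'M[A]_2 :=
  (2%:M : A) *: tens theta (frame i)
  - ((mu%:C)%C%:M : A) *:
      \sum_(k < 2) (epsilon i k *: pauli i) *: tens (frame i) (frame k).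

(* The values sigma (s^i (x) s^j) of the braiding. *)
Definition braid (mu : R) (i j : 'I_2) : 'M[A]_2 :=
  - tens (frame j) (frame i)
  - ((2 * 'i * (mu%:C)%C * (i == j)%:R)%:M : A) *:
      \sum_(k < 2) ((epsilon i k)%:M : A) *: tens (frame i) (frame k).

(* Christoffel symbols Gamma^i_jk and coefficients sigma^ij_kl, defined by
   nabla s^i = -1/2 Gamma^i_jk s^j (x) s^k and
   sigma (s^i (x) s^j) = sigma^ij_kl s^k (x) s^l. *)
Definition Gamma (mu : R) (i j k : 'I_2) : A := (- 2) *: nabla mu i j k.

Definition braid_coef (mu : R) (i j k l : 'I_2) : A := braid mu i j k l.

(* Matrices in spinor indices (row alpha, column beta) have entries in C or
   in A; toA embeds the former in the latter. *)
Definition toA (M : 'M[C]_2) : 'M[A]_2 := map_mx scalar_mx M.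

Definition conj_mx (M : 'M[C]_2) : 'M[C]_2 := map_mx Num.conj M.

(* Entrywise star: the spinor indices are not transposed. *)
Definition star_mx (M : 'M[A]_2) : 'M[A]_2 := map_mx star M.

Definition comm_mx2 (M N : 'M[C]_2) : 'M[C]_2 := M *m N - N *m M.

Definition clifford (c0 c1 c2 c3 c4 : C) (i : 'I_2) : 'M[C]_2 :=
  if i == 0 then mx2 c1 c2 ((c0 - c1 ^+ 2) / c2) (- c1)
  else mx2 c3 c4 ((c0 - c3 ^+ 2) / c4) (- c3).

Definition generic_clifford (c0 c1 c2 c3 c4 : C) : Prop :=
  [/\ c2 != 0, c4 != 0 &
      comm_mx2 (clifford c0 c1 c2 c3 c4 0) (clifford c0 c1 c2 c3 c4 1)
        \in unitmx].

(* The generalised braiding sigma_S(e^alpha (x) s^j) is given by the matrices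
   sS j i = (sigma_S^j_i), upper index first. The connection is the inner one,
   nabla_S = theta (x) ( ) - sigma_S (( ) (x) theta). *)
Definition spin_conn (sS : 'I_2 -> 'I_2 -> 'M[C]_2) (i : 'I_2) : 'M[A]_2 :=
  (('i / 2)%:M : A) *:
    ((pauli i)%:M - \sum_(j < 2) pauli j *: toA (sS j i)).

Definition cond_J (J : 'M[C]_2) (sS : 'I_2 -> 'I_2 -> 'M[C]_2) : Prop :=
  forall i : 'I_2,
    \sum_(j < 2) star_mx (spin_conn sS j) *m toA J *m toA (sS j i)
    = toA J *m spin_conn sS i.

Definition cond_clifford_J (Cl : 'I_2 -> 'M[C]_2) (J : 'M[C]_2) (e' : C)
    (sS : 'I_2 -> 'I_2 -> 'M[C]_2) : Prop :=
  forall i : 'I_2,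
    conj_mx (Cl i) *m J = e' *: \sum_(j < 2) J *m sS i j *m Cl j.

Definition cond_clifford_conn (mu : R) (Cl : 'I_2 -> 'M[C]_2)
    (sS : 'I_2 -> 'I_2 -> 'M[C]_2) : Prop :=
  forall i j : 'I_2,
    toA (Cl i) *m spin_conn sS j
    - \sum_(k < 2) \sum_(l < 2)
        braid_coef mu i k j l *: (spin_conn sS k *m toA (Cl l))
    = ((- 2^-1)%:M : A) *: \sum_(k < 2) Gamma mu i j k *: toA (Cl k).

Definition local_conditions (mu : R) (Cl : 'I_2 -> 'M[C]_2) (J : 'M[C]_2)
    (e' : C) (sS : 'I_2 -> 'I_2 -> 'M[C]_2) : Prop :=
  [/\ cond_J J sS, cond_clifford_J Cl J e' sS & cond_clifford_conn mu Cl sS].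

Definition gamma_conditions (Cl : 'I_2 -> 'M[C]_2) (J : 'M[C]_2) (e'' : C)
    (sS : 'I_2 -> 'I_2 -> 'M[C]_2) (gamma : 'M[C]_2) : Prop :=
  [/\ gamma *m gamma = 1%:M,
      forall i : 'I_2, Cl i *m gamma + gamma *m Cl i = 0,
      conj_mx gamma *m J = e'' *: (J *m gamma) &
      forall i : 'I_2,
        spin_conn sS i *m toA gamma = toA gamma *m spin_conn sS i].

Definition braiding_of (K zeta : 'M[C]_2) (i j : 'I_2) : 'M[C]_2 :=
  zeta i j *: K.

Definition clifford_reality (Cl : 'I_2 -> 'M[C]_2) (J : 'M[C]_2) (e' : C)
    (zeta : 'M[C]_2) : Prop :=
  forall i : 'I_2,
    conj_mx (Cl i) =
    e' *: \sum_(j < 2)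
      zeta i j *: (J *m comm_mx2 (Cl 0) (Cl 1) *m Cl j *m invmx J).

End Calculus.

(* Main.v *)
Require Import Defs.
From mathcomp Require Import all_boot all_order all_algebra.
From mathcomp Require Import complex.
From mathcomp Require Import reals.
From mathcomp Require Import ring.
Import Order.TTheory GRing.Theory Num.Theory.
Local Open Scope ring_scope.

(** Write C^0, C^1 for the two Clifford matrices and K for their commutator.
    Since the squares of C^0 and C^1 are scalar, K anticommutes with both; it
    is traceless, so K^2 = - det K.

    Each spinor connection coefficient S_i is a combination of the two Pauli
    matrices sigma^k with scalar spinor matrices as coefficients, and these
    two Pauli matrices are linearly independent.  A condition on the S_i
    therefore holds coefficient by coefficient ([cond_JE],
    [cond_clifford_connE]), and the inhomogeneous terms cancel.  In terms of tau X = J^-1 conj(X) J, an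
    antilinear ring automorphism which is an involution because conj(J) J is
    a sign, what remains is

    - (a) sum_j tau(sS k j) sS j i = delta_ki,
    - (b) tau(C^i) = e' sum_j sS i j C^j,
    - (c) {C^i, sS k j} = - 2 i mu delta_ij sS k i sum_l epsilon_il C^l.

    By (c) every sS k j commutes with K, hence is a + b K; anticommutation
    with one of the C^i removes a, and then the left side of (c) vanishes
    altogether ([braiding_solutions]).  So sS = zeta K with mu zeta = 0.  As
    (b) excludes zeta = 0, the parameter mu is 0.

    Now (b) says that tau maps the vector (C^0, C^1) to e' zeta K (C^0, C^1).
    Taking the commutator of the two entries gives tau K = det zeta det K K
    ([tau_commutator]), so zeta is invertible.  Applying tau once more and
    using that C^0, C^1 are independent determines conj(zeta) zeta
    ([conj_zeta_mul_zeta]), and the value found is what (a) asks for.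

    For existence at mu = 0 it is enough that tau preserve the span of C^0 and
    C^1, and this holds when it preserves the line of their commutator, for
    then it preserves the space of matrices anticommuting with K.  Some
    traceless invertible matrix spans a line preserved by tau
    ([exists_tau_eigen]), and for any such matrix K a Clifford pair with
    commutator on that line is P and a multiple of P K, where P anticommutes
    with K ([anticommuting_traceless]).

    A grading gamma solves the system (c) for mu = 0, so it is a multiple of
    K too, and gamma^2 = 1 fixes the factor up to sign. *)

(** * Matrices of size two *)

Lemma sum_ord2 (V : nmodType) (F : 'I_2 -> V) : \sum_(k < 2) F k = F 0 + F 1.
Proof.
rewrite big_ord_recl big_ord_recl big_ord0 addr0.
by congr (_ + F _); apply: val_inj.
Qed.

Lemma ord2_ind (P : 'I_2 -> Prop) : P 0 -> P 1 -> forall k, P k.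
Proof.
move=> P0 P1 [[|[|//]] lt_k2]; [have -> : Ordinal lt_k2 = 0 |
  have -> : Ordinal lt_k2 = 1]; by [apply: val_inj |].
Qed.

Lemma mx2_ext (T : Type) (M N : 'M[T]_2) :
  M 0 0 = N 0 0 -> M 0 1 = N 0 1 -> M 1 0 = N 1 0 -> M 1 1 = N 1 1 -> M = N.
Proof.
by move=> h00 h01 h10 h11; apply/matrixP; elim/ord2_ind; elim/ord2_ind.
Qed.

Lemma det_mx2 (F : comNzRingType) (M : 'M[F]_2) :
  \det M = M 0 0 * M 1 1 - M 0 1 * M 1 0.
Proof.
rewrite (expand_det_row _ 0) sum_ord2 /cofactor !det_mx11 !mxE /=.
have -> : lift 0 0 = 1 :> 'I_2 by apply: val_inj.
have -> : lift 1 0 = 0 :> 'I_2 by apply: val_inj.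
ring.
Qed.

Lemma det2_parallelogram (F : comNzRingType) (M N : 'M[F]_2) :
  \det (M + N) + \det (M - N) = 2 * (\det M + \det N).
Proof. by rewrite !det_mx2 !mxE; ring. Qed.

Lemma mxtrace2 (V : nmodType) (M : 'M[V]_2) : \tr M = M 0 0 + M 1 1.
Proof. exact: sum_ord2. Qed.

Section Mx2.
Variable F : numFieldType.
Implicit Types (P Q X K : 'M[F]_2).

Lemma tr0_corner K : \tr K = 0 -> K 1 1 = - K 0 0.
Proof. by move/eqP; rewrite mxtrace2 addrC addr_eq0 => /eqP. Qed.

(** The polarisation of [traceless_sqr]: traceless matrices form a quadratic
    space in which anticommuting means orthogonal for the trace form. *)
Lemma traceless_anticomm P Q : \tr P = 0 -> \tr Q = 0 ->
  P * Q + Q * P = (\tr (P * Q))%:M.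
Proof.
move=> /tr0_corner p /tr0_corner q; apply: mx2_ext;
  rewrite mxtrace2 !mxE !sum_ord2 ?p ?q /=; ring.
Qed.

Lemma traceless_sqr K : \tr K = 0 -> K * K = (- \det K)%:M.
Proof.
move=> /tr0_corner k; apply: mx2_ext; rewrite det_mx2 !mxE !sum_ord2 k /=; ring.
Qed.

(** The traceless part Y of X commutes with K, so the anticommutator 2 Y K is a
    scalar and Y is a multiple of K^-1, that is of K. *)
Lemma traceless_commutant K X : \tr K = 0 -> K \in unitmx -> X * K = K * X ->
  exists a b, X = a%:M + b *: K.
Proof.
move=> trK uK XK; set a := \tr X / 2; set Y := X - a%:M.
have trY : \tr Y = 0.
  by rewrite mxtrace2 !mxE /= /a mxtrace2 !mulr1n; field.
have dK : \det K != 0 by rewrite -unitfE.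
have := traceless_anticomm _ _ trY trK.
have -> : K * Y = Y * K.
  by rewrite mulrBr mulrBl XK -[a%:M]scalemx1 -scalerAl -scalerAr mul1r mulr1.
move/(congr1 (fun Z => Z * K)); rewrite mulrDl -mulrA traceless_sqr //.
set t := \tr _; rewrite -!mulmxE mul_scalar_mx mul_mx_scalar => eYK.
exists a, (t / (- \det K *+ 2)).
have d2 : - \det K *+ 2 != 0 by rewrite mulrn_eq0 oppr_eq0.
rewrite -[LHS](subrK a%:M) -/Y addrC; congr (_ + _).
apply: (scalerI d2); rewrite scalerA mulrCA divff // mulr1 -eYK.
by rewrite mulr2n scalerDl.
Qed.

Lemma tr_commutator P Q : \tr (P * Q - Q * P) = 0.
Proof. by rewrite raddfB /= [\tr (P * Q)]mxtrace_mulC subrr. Qed.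

Lemma commutator_anticomm p P Q : P * P = p%:M ->
  P * (P * Q - Q * P) = - ((P * Q - Q * P) * P).
Proof.
move=> PP; rewrite mulrBr mulrBl !mulrA PP -!(mulrA Q) PP opprB; congr (_ - _).
by rewrite -!mulmxE mul_scalar_mx mul_mx_scalar.
Qed.

Lemma commutator_anticomm_r q P Q : Q * Q = q%:M ->
  Q * (P * Q - Q * P) = - ((P * Q - Q * P) * Q).
Proof.
move=> QQ; rewrite -[P * Q - _]opprB mulrN mulNr; congr (- _).
exact: commutator_anticomm QQ.
Qed.

Lemma commutator_combination a b c d P Q :
  (a *: P + b *: Q) * (c *: P + d *: Q) - (c *: P + d *: Q) * (a *: P + b *: Q)
  = (a * d - b * c) *: (P * Q - Q * P).
Proof. by apply: mx2_ext; rewrite !mxE !sum_ord2 !mxE; ring. Qed.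

(** * Pairs of matrices with scalar squares *)

Section CliffordPair.
Variables (p q : F) (P Q : 'M[F]_2).
Hypotheses (PP : P * P = p%:M) (QQ : Q * Q = q%:M).
Let K := P * Q - Q * P.
Hypothesis unitK : K \in unitmx.

Lemma commutator_neq0 : K != 0.
Proof. by apply: contraTneq unitK => ->; rewrite unitmxE det0 unitr0. Qed.

Lemma clifford_neq0 : Q != 0.
Proof.
by apply: contraNneq commutator_neq0 => P0; rewrite /K P0 mul0r mulr0 subrr.
Qed.

(** Commutators of the combination with Q and with P isolate x K and y K. *)
Lemma clifford_free x y : x *: P + y *: Q = 0 -> x = 0 /\ y = 0.
Proof.
move=> xy0.
have eK Y : Y *: K = 0 -> Y = 0.
  by move/eqP; rewrite scalemx_eq0 (negPf commutator_neq0) orbF => /eqP.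
split; apply: eK.
  have := commutator_combination x y 0 1 P Q.
  by rewrite xy0 mul0r mulr0 subrr mulr1 mulr0 subr0.
have := commutator_combination 1 0 x y P Q.
by rewrite xy0 mul0r mulr0 subrr mul1r mul0r subr0.
Qed.

(** The crossed terms m X Q^2 cancel in [P Q - Q P, X], so X commutes with K and
    is a + b K.  As K anticommutes with P and Q, the first equation gives a = 0
    and the second reduces to m b K Q = 0. *)
Lemma braiding_solutions m X :
  Q * X + X * Q = 0 -> P * X + X * P = m *: (X * Q) ->
  exists2 b, X = b *: K & m * b = 0.
Proof.
move=> /eqP; rewrite addr_eq0 => /eqP QX PX'.
have PX : P * X = m *: (X * Q) - X * P by rewrite -PX' addrK.
have trK : \tr K = 0 by apply: tr_commutator.
have [|a [b eX]] := @traceless_commutant K X trK unitK.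
  rewrite /K mulrBr mulrBl -(mulrA P) QX mulrN (mulrA P) PX -(mulrA Q P) PX.
  rewrite mulrBl mulrBr opprB -scalerAr -scalerAl !mulrA QX !mulNr scalerN.
  by rewrite opprK opprD opprK addrA subrK.
have QK : Q * K = - (K * Q) by apply: commutator_anticomm_r QQ.
have PK : P * K = - (K * P) by apply: commutator_anticomm PP.
have a0 : a = 0.
  move: QX; rewrite eX mulrDr mulrDl -scalerAr QK -scalerAl scalerN opprD.
  move/addIr; rewrite -!mulmxE mul_scalar_mx mul_mx_scalar => /eqP.
  rewrite -addr_eq0 -scalerDl scalemx_eq0 (negPf clifford_neq0) orbF.
  by rewrite -mulr2n mulrn_eq0 => /eqP.
exists b; first by rewrite eX a0 -scalemx1 scale0r add0r.
move: PX'; rewrite eX a0 -scalemx1 scale0r add0r -scalerAr PK -!scalerAl.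
rewrite scalerN addNr => /esym/eqP; rewrite scalerA scalemx_eq0.
case/orP=> [/eqP //|/eqP KQ]; case/eqP: clifford_neq0.
by rewrite -[LHS](mulKmx unitK) (KQ : K *m Q = 0) mulmx0.
Qed.

(** Since K anticommutes with P and Q, a product (K P)(K Q) is - K^2 P Q. *)
Lemma skew_commutators z00 z01 z10 z11 :
  (z00 *: (K * P) + z01 *: (K * Q)) * (z10 *: (K * P) + z11 *: (K * Q))
  - (z10 *: (K * P) + z11 *: (K * Q)) * (z00 *: (K * P) + z01 *: (K * Q))
  = ((z00 * z11 - z01 * z10) * \det K) *: K.
Proof.
have trK : \tr K = 0 by apply: tr_commutator.
have QK : Q * K = - (K * Q) by apply: commutator_anticomm_r QQ.
have PK : P * K = - (K * P) by apply: commutator_anticomm PP.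
have mv Y Z : Y * K = - (K * Y) -> K * Y * (K * Z) = \det K *: (Y * Z).
  move=> YK; rewrite mulrA -(mulrA K) YK mulrN mulNr mulrA traceless_sqr //.
  by rewrite -!mulrA -mulmxE mul_scalar_mx scaleNr opprK.
by rewrite commutator_combination !mv // -scalerBr scalerA.
Qed.

(** X P commutes with K, hence X P = a + b K; multiply by P on the
    right and use that P is a multiple of K Q. *)
Lemma anticommutant_basis X : P * Q = - (Q * P) -> p != 0 -> q != 0 ->
  X * K = - (K * X) -> exists a b, X = a *: (K * P) + b *: (K * Q).
Proof.
move=> PQ p0 q0 XK.
have trK : \tr K = 0 by apply: tr_commutator.
have PK : P * K = - (K * P) by apply: commutator_anticomm PP.
have [|a [b eXP]] := @traceless_commutant K (X * P) trK unitK.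
  by rewrite -(mulrA X) PK mulrN (mulrA X K) XK mulNr opprK mulrA.
have eKQ : K * Q = (q *+ 2) *: P.
  rewrite /K -[Q * P]opprK -PQ opprK mulrDl -mulrA QQ -mulmxE mul_mx_scalar.
  by rewrite -mulr2n scalerMnl.
exists (p^-1 * b), (p^-1 * (a / (q *+ 2))).
have q20 : q *+ 2 != 0 by rewrite mulrn_eq0.
rewrite eKQ scalerA -mulrA divfK // addrC -!scalerA -scalerDr.
have /(congr1 (fun Y => Y * P)) := eXP.
rewrite -mulrA PP mulrDl -scalerAl -!mulmxE mul_scalar_mx mul_mx_scalar => <-.
by rewrite scalerA mulVf // scale1r.
Qed.
End CliffordPair.

Lemma clifford_form c (M : 'M[F]_2) : \tr M = 0 -> M * M = c%:M -> M 0 1 != 0 ->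
  M = mx2 (M 0 0) (M 0 1) ((c - M 0 0 ^+ 2) / M 0 1) (- M 0 0).
Proof.
move=> /tr0_corner M11 MM M01; have := congr1 (fun Y : 'M_2 => Y 0 0) MM.
rewrite !mxE sum_ord2 mulr1n => <-.
by apply: mx2_ext; rewrite !mxE //=; field.
Qed.

(** The entries at (0, 1) have to be nonzero because the parametrisation of
    the Clifford matrices divides by them.  Here X is sought with X 0 1 = 1, as
    the matrix with rows (x, 1) and (z, - x). *)
Lemma anticommuting_traceless K s : \tr K = 0 -> s ^+ 2 = \det K -> s != 0 ->
  exists X : 'M[F]_2, [/\ \tr X = 0, X * K = - (K * X), X \in unitmx,
    X 0 1 != 0 & (X * K) 0 1 != 0].
Proof.
move=> trK; rewrite det_mx2 (tr0_corner _ trK) => eqs s0.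
suff [x [z [ep d0 o0]]] : exists x z : F, [/\
    K 0 0 * x *+ 2 + z * K 0 1 + K 1 0 = 0, x ^+ 2 + z != 0 &
    x * K 0 1 - K 0 0 != 0].
  exists (mx2 x 1 z (- x)).
  have trX : \tr (mx2 x 1 z (- x)) = 0 by rewrite mxtrace2 !mxE /= subrr.
  split => //; rewrite ?mxE ?oner_eq0 //=.
  - apply/eqP; rewrite -addr_eq0 traceless_anticomm //.
    rewrite (_ : \tr _ = 0) ?raddf0 // -[RHS]ep.
    by rewrite mxtrace2 !mxE !sum_ord2 !mxE /= (tr0_corner _ trK); ring.
  - rewrite unitmxE unitfE det_mx2 !mxE /=.
    by rewrite mulrN mul1r -opprD oppr_eq0 -expr2.
  - by rewrite sum_ord2 !mxE /= (tr0_corner _ trK) mul1r.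
have [q0|q0] := eqVneq (K 0 1) 0.
  have p0 : K 0 0 != 0.
    apply: contraNneq s0 => p0; rewrite -sqrf_eq0 eqs p0 q0; apply/eqP; ring.
  exists (- K 1 0 / (K 0 0 *+ 2)), (1 - (K 1 0 / (K 0 0 *+ 2)) ^+ 2).
  rewrite q0; split; first by field.
    by rewrite mulNr sqrrN addrC subrK oner_eq0.
  by rewrite mulr0 sub0r oppr_eq0.
(* Orthogonality determines z from x.  The two remaining inequalities then ask
   that (q x - p)^2 differ from 0 and from p^2 + q r = - s^2, for K with rows
   (p, q) and (r, - p); the choice q x - p = s does both. *)
exists ((K 0 0 + s) / K 0 1),
  (- (K 0 0 * ((K 0 0 + s) / K 0 1) *+ 2 + K 1 0) / K 0 1).
split; first by field.
  suff -> : ((K 0 0 + s) / K 0 1) ^+ 2 +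
    - (K 0 0 * ((K 0 0 + s) / K 0 1) *+ 2 + K 1 0) / K 0 1
    = s ^+ 2 / K 0 1 ^+ 2 *+ 2.
    by rewrite mulrn_eq0 /= mulf_neq0 ?invr_eq0 ?expf_neq0.
  have -> : s ^+ 2 / K 0 1 ^+ 2 *+ 2 = (s ^+ 2 + s ^+ 2) / K 0 1 ^+ 2.
    by rewrite mulr2n mulrDl.
  rewrite {2}eqs; field; exact: q0.
by rewrite divfK // addrC addKr.
Qed.
End Mx2.

(** * Separation of the Pauli coefficients *)

Lemma sum_delta (K : pzRingType) (V : lmodType K) (F : 'I_2 -> V) j :
  \sum_(k < 2) (j == k)%:R *: F k = F j.
Proof.
rewrite (bigD1 j) //= eqxx scale1r big1 ?addr0 // => k /negPf.
by rewrite eq_sym => ->; rewrite scale0r.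
Qed.

Section Reduction.
Variable R : realType.
Local Notation C := R[i].
Local Notation A := 'M[C]_2.
Implicit Types (M N : 'M[C]_2) (F G : 'I_2 -> 'M[C]_2).

Definition pauli_comb F : 'M[A]_2 := \sum_(k < 2) pauli R k *: toA (F k).

Lemma toAM M N : toA (M *m N) = toA M *m toA N.
Proof. exact: (map_mxM (scalar_mx : C -> A)). Qed.

Lemma toAZ (c : C) M : toA (c *: M) = (c%:M : A) *: toA M.
Proof. exact: (map_mxZ (scalar_mx : C -> A)). Qed.

(** Although [A] is not commutative, its elements commute with the scalars that
    are the entries of [toA M]. *)
Lemma toA_mulZ (a : A) M (T : 'M[A]_2) : toA M *m (a *: T) = a *: (toA M *m T).
Proof.
apply/matrixP=> i j; rewrite !mxE mulr_sumr; apply: eq_bigr => k _.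
by rewrite !mxE !mulrA; congr (_ * _); rewrite -!mulmxE scalar_mxC.
Qed.

Lemma pauli_comb_mull N F :
  toA N *m pauli_comb F = pauli_comb (fun k => N *m F k).
Proof.
by rewrite /pauli_comb mulmx_sumr; apply: eq_bigr => k _; rewrite toA_mulZ toAM.
Qed.

Lemma pauli_comb_mulr N F :
  pauli_comb F *m toA N = pauli_comb (fun k => F k *m N).
Proof.
rewrite /pauli_comb mulmx_suml; apply: eq_bigr => k _.
by rewrite -scalemxAl toAM.
Qed.

Lemma pauli_combD F G :
  pauli_comb F + pauli_comb G = pauli_comb (fun k => F k + G k).
Proof.
rewrite /pauli_comb -big_split; apply: eq_bigr => k _ /=.
by rewrite -scalerDr; congr (_ *: _); rewrite /toA raddfD.
Qed.

Lemma pauli_combZ c F :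
  (c%:M : A) *: pauli_comb F = pauli_comb (fun k => c *: F k).
Proof.
rewrite /pauli_comb scaler_sumr; apply: eq_bigr => k _ /=.
by rewrite toAZ !scalerA -!mulmxE scalar_mxC.
Qed.

Lemma pauli_comb_sum (I : finType) (H : I -> 'I_2 -> 'M[C]_2) :
  \sum_j pauli_comb (H j) = pauli_comb (fun k => \sum_j H j k).
Proof.
rewrite /pauli_comb exchange_big; apply: eq_bigr => k _ /=.
by rewrite -scaler_sumr; congr (_ *: _); rewrite /toA raddf_sum.
Qed.

Lemma eq_pauli_comb F G : F =1 G -> pauli_comb F = pauli_comb G.
Proof. by move=> FG; apply: eq_bigr => k _; rewrite FG. Qed.

Lemma pauli_comb_entry F a b :
  pauli_comb F a b = \sum_(k < 2) F k a b *: pauli R k.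
Proof.
rewrite /pauli_comb summxE; apply: eq_bigr => k _.
by rewrite mxE /toA mxE -mulmxE mul_mx_scalar.
Qed.

Lemma pauli_comb_inj F G : pauli_comb F = pauli_comb G -> F =1 G.
Proof.
move=> FG k; apply/matrixP=> a b.
have FGab :
    \sum_(k < 2) F k a b *: pauli R k = \sum_(k < 2) G k a b *: pauli R k.
  by rewrite -!pauli_comb_entry FG.
have := congr1 (fun T : 'M[C]_2 => T 0 1) FGab.
have := congr1 (fun T : 'M[C]_2 => T 1 0) FGab.
rewrite !sum_ord2 !mxE /= !mulr1 => e1 e2.
have solve (x y : C) : y = ((x + y * 'i) - (x + y * - 'i)) / ('i *+ 2).
  by field; rewrite neq0Ci.
have e : F 1 a b = G 1 a b.
  by rewrite (solve (F 0 a b) (F 1 a b)) e1 e2 -solve.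
elim/ord2_ind: k; last exact: e.
by move: e1; rewrite e => /addIr.
Qed.

(** The coefficient of sigma^k in S_i. *)
Definition spin_part (sS : 'I_2 -> 'I_2 -> 'M[C]_2) (i k : 'I_2) : 'M[C]_2 :=
  ('i / 2) *: ((k == i)%:R%:M - sS k i).

Lemma spin_connE sS i : spin_conn sS i = pauli_comb (spin_part sS i).
Proof.
rewrite /spin_conn -pauli_combZ; congr (_ *: _).
have -> : (pauli R i)%:M = pauli_comb (fun k => (k == i)%:R%:M).
  rewrite /pauli_comb (bigD1 i) //= eqxx big1 ?addr0 => [|k /negPf->].
    by rewrite -[LHS]scalemx1 [toA _](map_mx1 (scalar_mx : C -> A)).
  by rewrite -scalemx1 scale0r /toA raddf0 scaler0.
rewrite /pauli_comb -sumrB; apply: eq_bigr => k _.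
by rewrite -scalerBr; congr (_ *: _); rewrite /toA raddfB.
Qed.

Lemma star_pauli k : star (pauli R k) = pauli R k.
Proof.
elim/ord2_ind: k; apply: mx2_ext; rewrite !mxE /= ?rmorphN ?rmorph1 ?rmorph0 //.
  by rewrite conjCi.
by rewrite -[LHS]/(- 'i^*) conjCi opprK.
Qed.

Lemma star_pauli_comb F :
  star_mx (pauli_comb F) = pauli_comb (fun k => conj_mx (F k)).
Proof.
apply/matrixP=> a b; rewrite mxE !pauli_comb_entry /star raddf_sum /=.
rewrite map_mx_sum; apply: eq_bigr => k _.
by rewrite linearZ /= map_mxZ -/(star _) star_pauli mxE.
Qed.

(** As the Pauli matrices are self-adjoint, the star of S_j conjugates its
    coefficients, and conj(i / 2) = - i / 2 makes the terms sigma^j J sS j i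
    cancel against those of J S_i. *)
Lemma cond_JE (J : 'M[C]_2) (sS : 'I_2 -> 'I_2 -> 'M[C]_2) : cond_J J sS <->
  forall k i, \sum_(j < 2) conj_mx (sS k j) *m J *m sS j i = (k == i)%:R *: J.
Proof.
have i2 : 'i / 2 != 0 :> C by rewrite mulf_neq0 ?neq0Ci ?invr_eq0 ?pnatr_eq0.
have conj_part j k : conj_mx (spin_part sS j k)
    = - ('i / 2) *: ((k == j)%:R%:M - conj_mx (sS k j)).
  rewrite /conj_mx /spin_part map_mxZ map_mxB map_scalar_mx /= rmorph_nat.
  by rewrite rmorphM /= conjCi fmorphV rmorph_nat mulNr.
have eq_sides i :
    \sum_(j < 2) star_mx (spin_conn sS j) *m toA J *m toA (sS j i)
      = pauli_comb (fun k => - ('i / 2) *: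
          (J *m sS k i - \sum_(j < 2) conj_mx (sS k j) *m J *m sS j i))
    /\ toA J *m spin_conn sS i
      = pauli_comb (fun k => - ('i / 2) *: (J *m sS k i - (k == i)%:R *: J)).
  split; last first.
    rewrite spin_connE pauli_comb_mull; apply: eq_pauli_comb => k.
    rewrite /spin_part -scalemxAr mulmxBr mul_mx_scalar scaleNr -scalerN.
    by rewrite opprB.
  rewrite (eq_bigr (fun j => pauli_comb (fun k =>
     conj_mx (spin_part sS j k) *m J *m sS j i))); last first.
    by move=> j _; rewrite spin_connE star_pauli_comb !pauli_comb_mulr.
  rewrite pauli_comb_sum; apply: eq_pauli_comb => k.
  under eq_bigr do rewrite conj_part -!scalemxAl !mulmxBl mul_scalar_mx.
  rewrite -scaler_sumr; congr (_ *: _); rewrite sumrB; congr (_ - _).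
  rewrite (bigD1 k) //= eqxx scale1r big1 ?addr0 // => j /negPf.
  by rewrite eq_sym => ->; rewrite scale0r mul0mx.
split=> [h k i | h i].
  move: (h i); have [-> ->] := eq_sides i; move/pauli_comb_inj/(_ k) => /=.
  move/(scalerI (a := - ('i / 2))) => /(_ _)/addrI/oppr_inj -> //.
  by rewrite oppr_eq0.
by have [-> ->] := eq_sides i; apply: eq_pauli_comb => k; rewrite h.
Qed.

Lemma tensE (w v : 'rV[A]_2) a b : tens w v a b = w 0 a * v 0 b.
Proof. by rewrite /tens mxE big_ord_recl big_ord0 addr0 mxE. Qed.

Lemma frameE i j : frame R i 0 j = (j == i)%:R.
Proof. by rewrite /frame mxE eqxx. Qed.

Lemma scaleA_entry (a : A) (T : 'M[A]_2) i j : (a *: T) i j = a * T i j.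
Proof. exact: mxE. Qed.

Lemma frame_combE i j k (F : 'I_2 -> A) :
  (\sum_(l < 2) F l *: tens (frame R i) (frame R l)) j k = (j == i)%:R * F k.
Proof.
rewrite summxE (bigD1 k) //= big1 ?addr0 => [|l lk].
  by rewrite scaleA_entry tensE !frameE eqxx mulr1 mulr_natr mulr_natl.
by rewrite scaleA_entry tensE !frameE (eq_sym k) (negPf lk) !mulr0.
Qed.

Lemma nablaE (mu : R) i j k : nabla mu i j k =
  ('i * (k == i)%:R) *: pauli R j
  - ((mu%:C)%C * (j == i)%:R * epsilon R i k) *: pauli R i.
Proof.
rewrite /nabla mxE [X in _ + X]mxE !scaleA_entry frame_combE tensE frameE.
rewrite [theta R 0 j]mxE; congr (_ - _).
  rewrite -mulmxE mul_scalar_mx mulmxE mulr_natr scalerMnr scalerA.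
  by rewrite mulrCA divff ?pnatr_eq0 // mulr1 -scalerMnr scalerMnl mulr_natr.
rewrite -mulmxE mul_scalar_mx mulmxE mulr_natl.
by rewrite -scalerMnr scalerA scalerMnl mulr_natr mulrnAl.
Qed.

Lemma braid_coefE (mu : R) i k j l : braid_coef mu i k j l =
  (- ((j == k)%:R * (l == i)%:R)
   - 2 * 'i * (mu%:C)%C * (i == k)%:R * (j == i)%:R * epsilon R i l)%:M.
Proof.
rewrite /braid_coef /braid mxE [X in X + _]mxE [X in _ + X]mxE scaleA_entry.
rewrite frame_combE tensE !frameE raddfB raddfN /= !rmorphM /= !rmorph_nat.
by rewrite !mulrA.
Qed.

(** The terms of the Levi-Civita connection are those produced by the part
    sigma^j of S_j: the first is the anticommutator with C^i, and the one in mu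
    comes from the braiding, since (2 i mu) (i / 2) = - mu. *)
Lemma cond_clifford_connE (mu : R) Cl (sS : 'I_2 -> 'I_2 -> 'M[C]_2) :
  cond_clifford_conn mu Cl sS <->
  forall i j m, Cl i *m sS m j + sS m j *m Cl i =
    - (2 * 'i * (mu%:C)%C * (i == j)%:R) *:
       (sS m i *m \sum_(l < 2) epsilon R i l *: Cl l).
Proof.
have i2 : 'i / 2 != 0 :> C by rewrite mulf_neq0 ?neq0Ci ?invr_eq0 ?pnatr_eq0.
have lhsE i j :
  toA (Cl i) *m spin_conn sS j
    - \sum_(k < 2) \sum_(l < 2)
        braid_coef mu i k j l *: (spin_conn sS k *m toA (Cl l))
  = pauli_comb (fun m => Cl i *m spin_part sS j m + \sum_(k < 2) \sum_(l < 2)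
     ((j == k)%:R * (l == i)%:R
      + 2 * 'i * (mu%:C)%C * (i == k)%:R * (j == i)%:R * epsilon R i l) *:
     (spin_part sS k m *m Cl l)).
  rewrite -sumrN -pauli_combD -pauli_comb_sum spin_connE pauli_comb_mull.
  congr (_ + _); apply: eq_bigr => k _.
  rewrite -sumrN -pauli_comb_sum; apply: eq_bigr => l _.
  rewrite braid_coefE spin_connE pauli_comb_mulr pauli_combZ -[LHS]scaleN1r.
  rewrite -[- 1](_ : (- 1)%:M = - 1) ?pauli_combZ; last by rewrite raddfN.
  by apply: eq_pauli_comb => m; rewrite scaleN1r -scaleNr opprB opprK addrC.
have rhsE i j :
  ((- 2^-1)%:M : A) *: \sum_(k < 2) Gamma mu i j k *: toA (Cl k)
  = pauli_comb (fun m => ('i * (m == j)%:R) *: Cl i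
     - ((mu%:C)%C * (i == j)%:R * (m == j)%:R) *:
         \sum_(l < 2) epsilon R i l *: Cl l).
  have gammaE k : Gamma mu i j k *: toA (Cl k) = pauli_comb (fun m =>
     - 2 *: (('i * (k == i)%:R * (m == j)%:R) *: Cl k
     - ((mu%:C)%C * (j == i)%:R * epsilon R i k * (m == i)%:R) *: Cl k)).
    apply/matrixP=> a b; rewrite scaleA_entry pauli_comb_entry [toA _ a b]mxE.
    rewrite -mulmxE mul_mx_scalar /Gamma nablaE scalerA scalerBr !scalerA.
    have pick (c : C) l :
        c *: pauli R l = \sum_(n < 2) (c * (n == l)%:R) *: pauli R n.
      rewrite (bigD1 l) //= eqxx mulr1 big1 ?addr0 // => n /negPf ->.
      by rewrite mulr0 scale0r.
    rewrite !pick -sumrB; apply: eq_bigr => n _; rewrite -scalerBl.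
    by congr (_ *: _); rewrite !mxE; ring.
  under eq_bigr do rewrite gammaE.
  rewrite pauli_comb_sum pauli_combZ; apply: eq_pauli_comb => m.
  rewrite -scaler_sumr scalerA mulrNN mulVf ?pnatr_eq0 // scale1r sumrB.
  congr (_ - _).
    rewrite (bigD1 i) //= eqxx mulr1 big1 ?addr0 // => k /negPf ->.
    by rewrite mulr0 mul0r scale0r.
  rewrite scaler_sumr; apply: eq_bigr => k _; rewrite scalerA; congr (_ *: _).
  rewrite (eq_sym j); case: eqVneq => [->|_]; rewrite ?mulr0n; ring.
have key i j m :
  (Cl i *m spin_part sS j m + \sum_(k < 2) \sum_(l < 2)
     ((j == k)%:R * (l == i)%:R
      + 2 * 'i * (mu%:C)%C * (i == k)%:R * (j == i)%:R * epsilon R i l) *: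
     (spin_part sS k m *m Cl l))
  - (('i * (m == j)%:R) *: Cl i
     - ((mu%:C)%C * (i == j)%:R * (m == j)%:R) *:
         \sum_(l < 2) epsilon R i l *: Cl l)
  = - ('i / 2) *: (Cl i *m sS m j + sS m j *m Cl i
     - - (2 * 'i * (mu%:C)%C * (i == j)%:R) *:
       (sS m i *m \sum_(l < 2) epsilon R i l *: Cl l)).
  set E := \sum_(l < 2) epsilon R i l *: Cl l.
  have -> : \sum_(k < 2) \sum_(l < 2)
      ((j == k)%:R * (l == i)%:R
       + 2 * 'i * (mu%:C)%C * (i == k)%:R * (j == i)%:R * epsilon R i l) *:
      (spin_part sS k m *m Cl l)
    = spin_part sS j m *m Cl i
      + (2 * 'i * (mu%:C)%C * (i == j)%:R) *: (spin_part sS i m *m E).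
    under eq_bigr do under eq_bigr do rewrite scalerDl.
    under eq_bigr do rewrite big_split.
    rewrite big_split /=; congr (_ + _).
      transitivity (\sum_(k < 2) (j == k)%:R *:
          \sum_(l < 2) (i == l)%:R *: (spin_part sS k m *m Cl l)).
        apply: eq_bigr => k _; rewrite scaler_sumr; apply: eq_bigr => l _.
        by rewrite scalerA (eq_sym l).
      by rewrite !sum_delta.
    transitivity (\sum_(k < 2) (i == k)%:R *: \sum_(l < 2)
        (2 * 'i * (mu%:C)%C * (i == j)%:R * epsilon R i l) *:
        (spin_part sS k m *m Cl l)).
      apply: eq_bigr => k _; rewrite scaler_sumr; apply: eq_bigr => l _.
      by rewrite scalerA (eq_sym j); congr (_ *: _); ring.
    rewrite sum_delta /E mulmx_sumr scaler_sumr; apply: eq_bigr => l _.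
    by rewrite -scalemxAr scalerA.
  have -> : (mu%:C)%C * (i == j)%:R * (m == j)%:R
     = - ('i / 2 * (2 * 'i * (mu%:C)%C) * (i == j)%:R * (m == i)%:R).
    have -> : 'i / 2 * (2 * 'i * (mu%:C)%C) = 'i ^+ 2 * (mu%:C)%C by field.
    rewrite sqrCi mulN1r !mulNr opprK.
    by case: eqVneq => [->//|_]; rewrite mulr0 !mul0r.
  rewrite /spin_part -!scalemxAl -scalemxAr !mulmxBl mulmxBr mul_mx_scalar.
  have nz2 : 2 != 0 :> C by rewrite pnatr_eq0.
  rewrite !mul_scalar_mx -[X in (X * (m == j)%:R) *: Cl i](divfK nz2).
  move: ('i / 2) (2 * 'i * (mu%:C)%C) => x n.
  (* What is left is linear in C^i, E and three products. *)
  clearbody E.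
  move: E (Cl i) (Cl i *m _) (sS m j *m _) (sS m i *m E) => E c U V W.
  by apply/matrixP=> a b; rewrite !mxE; ring.
split=> [h i j m | h i j].
  move: (h i j); rewrite lhsE rhsE => /pauli_comb_inj/(_ m)/eqP.
  rewrite -subr_eq0 key scaler_eq0 oppr_eq0 (negPf i2) /=.
  by rewrite subr_eq0 => /eqP.
rewrite lhsE rhsE; apply: eq_pauli_comb => m; apply/eqP.
by rewrite -subr_eq0 key h subrr scaler0.
Qed.

End Reduction.

(** * The conjugation defined by J *)

Section Spinors.
Variable R : realType.
Local Notation C := R[i].

Lemma sign_sqr (e : C) : is_sign e -> e * e = 1.
Proof. by case=> ->; rewrite ?mulrNN mulr1. Qed.

Lemma sign_conj (e : C) : is_sign e -> e^* = e.
Proof. by case=> ->; rewrite ?rmorphN rmorph1. Qed.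

Lemma sign_neq0 (e : C) : is_sign e -> e != 0.
Proof. by case=> ->; rewrite ?oppr_eq0 oner_eq0. Qed.

Lemma conj_mxM (M N : 'M[C]_2) : conj_mx (M *m N) = conj_mx M *m conj_mx N.
Proof. exact: map_mxM. Qed.

Lemma conj_mxK (M : 'M[C]_2) : conj_mx (conj_mx M) = M.
Proof. by apply/matrixP=> i j; rewrite !mxE conjCK. Qed.

Section Tau.
Variables (eps : C) (J : 'M[C]_2).
Hypotheses (heps : is_sign eps) (hJ : conj_mx J *m J = eps%:M).
Implicit Types (X Y : 'M[C]_2) (a : C).

Lemma unit_J : J \in unitmx.
Proof.
have : eps%:M \in @unitmx C 2.
  by rewrite unitmxE det_scalar unitfE expf_neq0 ?sign_neq0.
by rewrite -hJ unitmx_mul => /andP[].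
Qed.

(** Conjugation of operators by the antilinear map of spinors given by J. *)
Definition tau X : 'M[C]_2 := invmx J *m conj_mx X *m J.

Lemma conj_tau X : conj_mx X = J *m tau X *m invmx J.
Proof. by rewrite /tau !mulmxA mulmxV ?unit_J // mul1mx mulmxK ?unit_J. Qed.

Lemma conj_mulJ X : conj_mx X *m J = J *m tau X.
Proof. by rewrite conj_tau mulmxKV ?unit_J. Qed.

Lemma tauM X Y : tau (X *m Y) = tau X *m tau Y.
Proof.
by rewrite /tau conj_mxM !mulmxA mulmxK ?unit_J.
Qed.

Lemma tauD X Y : tau (X + Y) = tau X + tau Y.
Proof. by rewrite /tau /conj_mx map_mxD mulmxDr mulmxDl. Qed.

Lemma tauN X : tau (- X) = - tau X.
Proof. by rewrite /tau /conj_mx map_mxN mulmxN mulNmx. Qed.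

Lemma tauZ a X : tau (a *: X) = a^* *: tau X.
Proof. by rewrite /tau /conj_mx map_mxZ /= -scalemxAr -scalemxAl. Qed.

Lemma tauK X : tau (tau X) = X.
Proof.
have uJ := unit_J; have e0 := sign_neq0 _ heps.
rewrite {1}/tau /tau !conj_mxM conj_mxK.
have eJ : conj_mx J = eps *: invmx J.
  by rewrite -[LHS](mulmxK uJ) hJ mul_scalar_mx.
have -> : conj_mx (invmx J) = invmx (conj_mx J) by apply: map_invmx.
rewrite eJ invmxZ ?unitmxZ ?unitfE ?unitmx_inv // invmxK.
rewrite -!scalemxAl -!scalemxAr -!scalemxAl scalerA mulVf // scale1r.
by rewrite !mulmxA mulVmx // mul1mx mulmxKV.
Qed.

Lemma det_tau X : \det (tau X) = (\det X)^*.
Proof.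
rewrite /tau !det_mulmx mulrAC det_inv mulVf ?mul1r ?det_map_mx //.
by rewrite -unitfE -unitmxE unit_J.
Qed.

Lemma tr_tau X : \tr (tau X) = (\tr X)^*.
Proof.
by rewrite /tau mxtrace_mulC mulmxA mulmxV ?unit_J // mul1mx [LHS]trace_map_mx.
Qed.

(** Both X + tau X and X - tau X are eigenvectors of the involution tau.  They
    cannot both be singular for X = diag(1, -1): their determinants add up to
    2 (det X + conj(det X)) = - 4. *)
Lemma exists_tau_eigen : exists K e,
  [/\ tau K = e *: K, is_sign e, \tr K = 0 & K \in unitmx].
Proof.
pose X : 'M[C]_2 := mx2 1 0 0 (- 1).
have trX : \tr X = 0 by rewrite mxtrace2 !mxE /= subrr.
have dX : \det X = - 1 by rewrite det_mx2 !mxE /= mulr0 subr0 mul1r.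
have par : \det (X + tau X) + \det (X - tau X) = - 4.
  by rewrite det2_parallelogram det_tau dX rmorphN rmorph1; ring.
have trT : \tr (tau X) = 0 by rewrite tr_tau trX rmorph0.
have [d0|d0] := eqVneq (\det (X + tau X)) 0; last first.
  exists (X + tau X), 1; split; [|by left| |by rewrite unitmxE unitfE].
    by rewrite tauD tauK scale1r addrC.
  by rewrite raddfD /= trX trT addr0.
exists (X - tau X), (- 1); split; [|by right| |].
- by rewrite tauD tauN tauK scaleN1r opprB addrC.
- by rewrite raddfB /= trX trT subr0.
- rewrite unitmxE unitfE; move: par; rewrite d0 add0r => ->.
  by rewrite oppr_eq0 pnatr_eq0.
Qed.

Lemma clifford_realityE (Cl : 'I_2 -> 'M[C]_2) e' (zeta : 'M[C]_2) :
  let K := comm_mx2 (Cl 0) (Cl 1) in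
  clifford_reality Cl J e' zeta <->
  forall i, tau (Cl i) = e' *: \sum_(j < 2) zeta i j *: (K *m Cl j).
Proof.
move=> K; have uJ := unit_J.
have sumE i : e' *: \sum_(j < 2) zeta i j *: (J *m K *m Cl j *m invmx J)
    = J *m (e' *: \sum_(j < 2) zeta i j *: (K *m Cl j)) *m invmx J.
  rewrite -scalemxAr -scalemxAl mulmx_sumr mulmx_suml; congr (_ *: _).
  by apply: eq_bigr => j _; rewrite -scalemxAr -scalemxAl !mulmxA.
split=> h i.
  have uJ' : invmx J \in unitmx by rewrite unitmx_inv.
  apply: (can_inj (mulKmx uJ)); apply: (can_inj (mulmxK uJ')).
  by rewrite -conj_tau h sumE.
by rewrite sumE -h conj_tau.
Qed.

Lemma cond_clifford_JE (Cl : 'I_2 -> 'M[C]_2) e'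
    (sS : 'I_2 -> 'I_2 -> 'M[C]_2) :
  cond_clifford_J Cl J e' sS <->
  forall i, tau (Cl i) = e' *: \sum_(j < 2) sS i j *m Cl j.
Proof.
have uJ := unit_J.
have sumE i : e' *: \sum_(j < 2) J *m sS i j *m Cl j
    = J *m (e' *: \sum_(j < 2) sS i j *m Cl j).
  rewrite -scalemxAr mulmx_sumr; congr (_ *: _).
  by apply: eq_bigr => j _; rewrite !mulmxA.
split=> h i.
  by apply: (can_inj (mulKmx uJ)); rewrite -sumE -h conj_mulJ.
by rewrite sumE -h conj_mulJ.
Qed.

Lemma cond_J_tauE (sS : 'I_2 -> 'I_2 -> 'M[C]_2) : cond_J J sS <->
  forall k i, \sum_(j < 2) tau (sS k j) *m sS j i = (k == i)%:R%:M.
Proof.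
have uJ := unit_J.
have sumE k i : \sum_(j < 2) conj_mx (sS k j) *m J *m sS j i
    = J *m \sum_(j < 2) tau (sS k j) *m sS j i.
  by rewrite mulmx_sumr; apply: eq_bigr => j _; rewrite conj_mulJ mulmxA.
rewrite cond_JE; split=> h k i.
  by apply: (can_inj (mulKmx uJ)); rewrite -sumE h mul_mx_scalar.
by rewrite sumE h mul_mx_scalar.
Qed.

(** * Solutions of the local conditions *)

Section CliffordModule.
Variables (Cl : 'I_2 -> 'M[C]_2) (c e' : C).
Hypothesis Cl_sqr : forall i, Cl i *m Cl i = c%:M.
Let K := comm_mx2 (Cl 0) (Cl 1).
Hypotheses (unitK : K \in unitmx) (he' : is_sign e').

Let trK : \tr K = 0. Proof. exact: tr_commutator. Qed.

Let detK_neq0 : \det K != 0.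
Proof. by rewrite -unitfE -unitmxE. Qed.

Lemma Cl_anticomm i : Cl i *m K = - (K *m Cl i).
Proof.
elim/ord2_ind: i; first exact: (commutator_anticomm _ _ _ _ (Cl_sqr 0)).
exact: (commutator_anticomm_r _ _ _ _ (Cl_sqr 1)).
Qed.

(** The column j = 1 is the column j = 0 for the exchanged pair and the
    opposite mu; the exchange also changes the sign of K. *)
Lemma braiding_form (mu : R) sS : cond_clifford_conn mu Cl sS <->
  exists zeta : 'M[C]_2, forall k j,
    sS k j = zeta k j *: K /\ (mu%:C)%C * zeta k j = 0.
Proof.
have i2 : 2 * 'i != 0 :> C by rewrite mulf_neq0 ?neq0Ci ?pnatr_eq0.
rewrite cond_clifford_connE; split=> [h | [zeta h] i j m].
  have {}h k j : exists b, sS k j = b *: K /\ (mu%:C)%C * b = 0.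
    elim/ord2_ind: j.
      have := h 1 0 k; have := h 0 0 k.
      rewrite !sum_ord2 /epsilon /= scale0r scale1r add0r mulr0 mulr1 oppr0.
      rewrite scale0r => h0 h1.
      have [b -> /eqP] := braiding_solutions _ _ _ _ _ (Cl_sqr 0) (Cl_sqr 1)
        unitK _ _ h1 h0.
      rewrite mulNr oppr_eq0 -(mulrA (2 * 'i)) mulf_eq0 (negPf i2).
      by move=> /eqP; exists b.
    have := h 0 1 k; have := h 1 1 k.
    rewrite !sum_ord2 /epsilon /= scale0r scaleN1r addr0 mulr0 mulr1 oppr0.
    rewrite scale0r.
    have unitK' : Cl 1 * Cl 0 - Cl 0 * Cl 1 \in unitmx.
      by rewrite -opprB -scaleN1r unitmxZ ?unitrN1.
    rewrite mulmxN scalerN -scaleNr opprK.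
    move=> h1 h0.
    have [b -> /eqP] := braiding_solutions _ _ _ _ _ (Cl_sqr 1) (Cl_sqr 0)
      unitK' _ _ h0 h1.
    rewrite -(mulrA (2 * 'i)) mulf_eq0 (negPf i2) => /eqP mub.
    by exists (- b); rewrite mulrN mub oppr0 scaleNr -scalerN opprB.
  have [z zP] := fin_all_exists (fun k => fin_all_exists (h k)).
  by exists (\matrix_(k, j) z k j) => k j; rewrite mxE.
have [-> _] := h m j; have [-> mu0] := h m i.
rewrite -scalemxAr -scalemxAl Cl_anticomm scalerN addNr -scalemxAl scalerA.
by rewrite mulNr mulrAC -(mulrA _ (mu%:C)%C) mu0 mulr0 mul0r oppr0 scale0r.
Qed.

Section Reality.
Variable zeta : 'M[C]_2.
Hypothesis real_Cl :
  forall i, tau (Cl i) = e' *: \sum_(j < 2) zeta i j *: (K *m Cl j).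

Lemma tau_commutator : tau K = (\det zeta * \det K) *: K.
Proof.
have signM X Y : (e' *: X) *m (e' *: Y) = X *m Y.
  by rewrite -scalemxAl -scalemxAr scalerA sign_sqr // scale1r.
rewrite {1}/K /comm_mx2 tauD tauN !tauM !real_Cl !signM !sum_ord2 det_mx2.
exact: (skew_commutators _ _ _ _ _ (Cl_sqr 0) (Cl_sqr 1)).
Qed.

(** If det zeta were 0, then tau K = 0 and K = 0. *)
Lemma zeta_unit : zeta \in unitmx.
Proof.
rewrite unitmxE unitfE; apply: contra_neq detK_neq0 => z0.
rewrite -[\det K]conjCK -det_tau tau_commutator z0 mul0r scale0r.
by rewrite det0 rmorph0.
Qed.

(** Applying tau twice gives C^i = sum_l u (conj(zeta) zeta)_il C^l with
    u = - (det K)^2 det zeta, and C^0, C^1 are independent. *)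
Lemma conj_zeta_mul_zeta :
  conj_mx zeta *m zeta = (- ((\det K) ^+ 2 * \det zeta)^-1)%:M.
Proof.
have dz : \det zeta != 0 by rewrite -unitfE -unitmxE zeta_unit.
set u := - ((\det K) ^+ 2 * \det zeta).
have u0 : u != 0 by rewrite oppr_eq0 mulf_neq0 ?expf_neq0.
suff e : conj_mx zeta *m zeta = u^-1%:M by rewrite e /u invrN.
have Cl_fixed i : Cl i = \sum_(l < 2) (u * (conj_mx zeta *m zeta) i l) *: Cl l.
  have tauKCl j : tau (K *m Cl j) = (e' * u) *: \sum_(l < 2) zeta j l *: Cl l.
    rewrite tauM tau_commutator real_Cl -scalemxAl -scalemxAr scalerA.
    rewrite mulmx_sumr !scaler_sumr; apply: eq_bigr => l _.
    rewrite -scalemxAr mulmxA (traceless_sqr _ _ trK : K *m K = _).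
    by rewrite mul_scalar_mx !scalerA; congr (_ *: _); rewrite /u; ring.
  rewrite -[LHS]tauK real_Cl tauZ sum_ord2 tauD !tauZ !tauKCl !sum_ord2 !mxE.
  have eu : u = e' * (e' * u) by rewrite mulrA sign_sqr // mul1r.
  rewrite !sum_ord2 !mxE sign_conj // [in RHS]eu.
  move: (e' * u) (Cl 0) (Cl 1) => v P Q.
  by apply/matrixP=> a b; rewrite !mxE; ring.
have Cl_free x0 x1 : x0 *: Cl 0 + x1 *: Cl 1 = 0 -> x0 = 0 /\ x1 = 0.
  exact: clifford_free unitK _ _.
have row i l : u * (conj_mx zeta *m zeta) i l = (i == l)%:R.
  have /eqP := Cl_fixed i; rewrite -subr_eq0 sum_ord2 => /eqP.
  elim/ord2_ind: i => Cl_i.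
    have [] := Cl_free (1 - u * (conj_mx zeta *m zeta) 0 0)
                       (- (u * (conj_mx zeta *m zeta) 0 1)).
      by rewrite scalerBl scale1r scaleNr -addrA -opprD.
    move=> /eqP; rewrite subr_eq0 => /eqP e0 /eqP; rewrite oppr_eq0 => /eqP e1.
    by elim/ord2_ind: l; rewrite -?e0 -?e1.
  have [] := Cl_free (- (u * (conj_mx zeta *m zeta) 1 0))
                     (1 - u * (conj_mx zeta *m zeta) 1 1).
    by rewrite scalerBl scale1r scaleNr addrCA -opprD.
  move=> /eqP; rewrite oppr_eq0 => /eqP e0 /eqP; rewrite subr_eq0 => /eqP e1.
  by elim/ord2_ind: l; rewrite -?e0 -?e1.
apply/matrixP=> i l; rewrite [RHS]mxE -[LHS](mulKf u0) row.
by rewrite mulr_natr.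
Qed.

End Reality.

Lemma sum_braiding zeta i (sS : 'I_2 -> 'I_2 -> 'M[C]_2) :
  (forall k j, sS k j = zeta k j *: K) ->
  \sum_(j < 2) sS i j *m Cl j = \sum_(j < 2) zeta i j *: (K *m Cl j).
Proof. by move=> sSE; apply: eq_bigr => j _; rewrite sSE -scalemxAl. Qed.

(** The sum in the first condition is conj(zeta) zeta times tau(K) K, two
    factors that are inverse scalars as soon as the C^i satisfy their reality
    condition. *)
Lemma local_conditions_of_reality (zeta : 'M[C]_2) sS :
  (forall k j, sS k j = zeta k j *: K) ->
  (forall i, tau (Cl i) = e' *: \sum_(j < 2) zeta i j *: (K *m Cl j)) ->
  local_conditions 0 Cl J e' sS.
Proof.
move=> sSE real_Cl; split.
- apply/cond_J_tauE => k i.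
  have dz : \det zeta != 0 by rewrite -unitfE -unitmxE (zeta_unit zeta).
  have sumE : \sum_(j < 2) tau (sS k j) *m sS j i
      = (conj_mx zeta *m zeta) k i *: (tau K *m K).
    rewrite [in RHS]mxE scaler_suml; apply: eq_bigr => j _.
    by rewrite !sSE tauZ -scalemxAl -scalemxAr scalerA mxE.
  rewrite sumE (tau_commutator zeta) // (conj_zeta_mul_zeta zeta) // -scalemxAl.
  rewrite (traceless_sqr _ _ trK : K *m K = _) mxE !scale_scalar_mx.
  congr (_%:M); case: (k == i); rewrite /= ?mulr0n ?mul0r // !mulr1n.
  by field; rewrite dz detK_neq0.
- by apply/cond_clifford_JE => i; rewrite real_Cl (sum_braiding zeta).
- apply/braiding_form; exists zeta => k j; split; first exact: sSE.
  by rewrite mul0r.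
Qed.

Lemma local_conditions_reality (mu : R) sS : local_conditions mu Cl J e' sS ->
  mu = 0 /\ exists zeta : 'M[C]_2, (forall k j, sS k j = zeta k j *: K) /\
    (forall i, tau (Cl i) = e' *: \sum_(j < 2) zeta i j *: (K *m Cl j)).
Proof.
case=> _ /cond_clifford_JE hb /braiding_form [zeta zetaP].
have sSE k j : sS k j = zeta k j *: K by have [] := zetaP k j.
have real_Cl i : tau (Cl i) = e' *: \sum_(j < 2) zeta i j *: (K *m Cl j).
  by rewrite hb (sum_braiding zeta).
split; last by exists zeta.
apply: contraTeq (zeta_unit _ real_Cl) => mu0.
suff -> : zeta = 0 by rewrite unitmxE det0 unitr0.
apply/matrixP=> k j; rewrite mxE; have [_ /eqP] := zetaP k j.
by rewrite mulf_eq0 fmorph_eq0 (negPf mu0) => /eqP.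
Qed.

(** Anticommuting with both C^i is the case m = 0 of [braiding_solutions].
    Conversely a multiple of K commutes with S_i, whose coefficients lie in the
    span of 1 and K. *)
Lemma gamma_conditionsE (sS : 'I_2 -> 'I_2 -> 'M[C]_2) zeta gamma e'' :
  (forall k j, sS k j = zeta k j *: K) ->
  gamma_conditions Cl J e'' sS gamma <->
  (exists r : C, r ^+ 2 = - \det K /\ gamma = r^-1 *: K) /\
  conj_mx gamma = e'' *: (J *m gamma *m invmx J).
Proof.
move=> sSE; have uJ := unit_J.
have KK : K *m K = (- \det K)%:M by exact: traceless_sqr.
have realE : conj_mx gamma *m J = e'' *: (J *m gamma) <->
    conj_mx gamma = e'' *: (J *m gamma *m invmx J).
  split=> h; first by rewrite -[LHS](mulmxK uJ) h -scalemxAl.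
  by rewrite h -scalemxAl mulmxKV.
split=> [[gg anti /realE rg _]|[[r [r2 gE]] /realE rg]].
  split=> //.
  have anti1 : Cl 0 * gamma + gamma * Cl 0 = 0 *: (gamma * Cl 1).
    by rewrite scale0r; apply: anti.
  have [b gE _] := braiding_solutions _ _ _ _ _ (Cl_sqr 0) (Cl_sqr 1) unitK _ _
    (anti 1) anti1.
  have b2 : b ^+ 2 * - \det K = 1.
    have := congr1 (fun X : 'M_2 => X 0 0) gg.
    rewrite gE -scalemxAl -scalemxAr (KK : _ *m _ = _) !mxE !mulr1n => <-.
    by rewrite expr2 mulrA.
  have b0 : b != 0.
    apply: contra_eq_neq b2 => ->; rewrite expr0n mul0r.
    by rewrite eq_sym oner_eq0.
  exists b^-1; rewrite invrK; split => //.
  by apply: (mulfI (expf_neq0 2 b0)); rewrite b2 -exprMn divff ?expr1n.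
have r0 : r != 0 by rewrite -sqrf_eq0 r2 oppr_eq0.
split=> //.
- rewrite gE -scalemxAl -scalemxAr KK -r2 !scale_scalar_mx; congr (_%:M).
  by field.
- by move=> i; rewrite gE -scalemxAr -scalemxAl Cl_anticomm scalerN addNr.
- move=> i; rewrite spin_connE pauli_comb_mulr pauli_comb_mull.
  apply: eq_pauli_comb => k; rewrite /spin_part sSE gE.
  rewrite -[LHS]scalemxAl -[RHS]scalemxAr; congr (_ *: _).
  rewrite mulmxBl mulmxBr scalar_mxC; congr (_ - _).
  by rewrite -!scalemxAr -!scalemxAl !scalerA mulrC.
Qed.

End CliffordModule.

Lemma clifford_sqr (c0 c1 c2 c3 c4 : C) i : c2 != 0 -> c4 != 0 ->
  clifford c0 c1 c2 c3 c4 i *m clifford c0 c1 c2 c3 c4 i = c0%:M.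
Proof.
move=> c20 c40; elim/ord2_ind: i; rewrite /clifford /=; apply: mx2_ext;
  rewrite !mxE sum_ord2 !mxE /= ?mulr1n ?mulr0n; field; rewrite ?c20 ?c40 //.
Qed.

(** With s^2 = det K, the factor s^-1 gives s^-1 P K the same square as P. *)
Lemma exists_local_solution : exists c0 c1 c2 c3 c4 : C,
  generic_clifford c0 c1 c2 c3 c4 /\
  exists sS : 'I_2 -> 'I_2 -> 'M[C]_2,
    local_conditions 0 (clifford c0 c1 c2 c3 c4) J 1 sS.
Proof.
have [K [e [tauK_ he trK unitK]]] := exists_tau_eigen.
have dK : \det K != 0 by rewrite -unitfE -unitmxE.
pose s := sqrtC (\det K).
have s2 : s ^+ 2 = \det K by rewrite sqrtCK.
have s0 : s != 0 by rewrite sqrtC_eq0.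
have [P [trP PK uP P01 PK01]] := anticommuting_traceless _ _ _ trK s2 s0.
have dP : \det P != 0 by rewrite -unitfE -unitmxE.
pose Q := s^-1 *: (P * K); pose c := - \det P.
have c_neq0 : c != 0 by rewrite oppr_eq0.
have PP : P * P = c%:M by apply: traceless_sqr.
have KK : K * K = (- s ^+ 2)%:M by rewrite s2; apply: traceless_sqr.
have PKP : P * K * P = - c *: K.
  by rewrite PK mulNr -mulrA PP -mulmxE mul_mx_scalar -scaleNr.
have QQ : Q * Q = c%:M.
  rewrite /Q -scalerAl -scalerAr mulrA PKP -scalerAl KK.
  by rewrite !scale_scalar_mx; congr (_%:M); field.
have PQ : P * Q = (s^-1 * c) *: K.
  by rewrite /Q -scalerAr mulrA PP -mulmxE mul_scalar_mx scalerA.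
have QP : Q * P = - (P * Q).
  by rewrite PQ /Q -scalerAl PKP scalerA mulrN scaleNr.
have trQ : \tr Q = 0.
  rewrite /Q mxtraceZ.
  have /eqP : \tr (P * K) = - \tr (P * K).
    by rewrite {1}PK raddfN /= [\tr (K * P)]mxtrace_mulC.
  by rewrite -addr_eq0 -mulr2n mulrn_eq0 => /eqP ->; rewrite mulr0.
have Q01 : Q 0 1 != 0 by rewrite mxE mulf_neq0 ?invr_eq0.
pose Cl := clifford c (P 0 0) (P 0 1) (Q 0 0) (Q 0 1).
have Cl0 : Cl 0 = P by rewrite [RHS](clifford_form _ _ _ trP PP P01).
have Cl1 : Cl 1 = Q by rewrite [RHS](clifford_form _ _ _ trQ QQ Q01).
have commE : comm_mx2 (Cl 0) (Cl 1) = (s^-1 * c *+ 2) *: K.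
  rewrite Cl0 Cl1 /comm_mx2 !mulmxE QP opprK PQ -scalerDl.
  by rewrite mulr2n.
have k0 : s^-1 * c *+ 2 != 0 by rewrite mulrn_eq0 /= mulf_neq0 ?invr_eq0.
have unit_comm : comm_mx2 (Cl 0) (Cl 1) \in unitmx.
  by rewrite commE unitmxZ ?unitfE.
have anti i : Cl i * K = - (K * Cl i).
  apply: (scalerI k0); rewrite scalerN scalerAr scalerAl -commE.
  by apply: Cl_anticomm => j; apply: clifford_sqr.
have real_Cl i : exists a b, tau (Cl i) =
    a *: (comm_mx2 (Cl 0) (Cl 1) * Cl 0) + b *: (comm_mx2 (Cl 0) (Cl 1) * Cl 1).
  rewrite Cl0 Cl1; apply: (anticommutant_basis _ c c) => //.
  - by rewrite -Cl0 -Cl1.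
  - by rewrite QP opprK.
  - have -> : P * Q - Q * P = (s^-1 * c *+ 2) *: K by rewrite -commE Cl0 Cl1.
    rewrite -scalerAr -scalerAl -scalerN; congr (_ *: _).
    have tK : K = e *: tau K by rewrite tauK_ scalerA sign_sqr // scale1r.
    rewrite {1}tK [in RHS]tK -scalerAr -scalerAl -scalerN; congr (_ *: _).
    by rewrite -!mulmxE -!tauM -tauN; congr (tau _); apply: anti.
have [a0 [b0 r0]] := real_Cl 0; have [a1 [b1 r1]] := real_Cl 1.
exists c, (P 0 0), (P 0 1), (Q 0 0), (Q 0 1); split; first by split.
pose zeta : 'M[C]_2 := mx2 a0 b0 a1 b1.
exists (braiding_of (comm_mx2 (Cl 0) (Cl 1)) zeta).
apply: (@local_conditions_of_reality Cl c 1 _ _ _ zeta) => //.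
- by move=> i; apply: clifford_sqr.
- by left.
- by elim/ord2_ind; rewrite sum_ord2 !mxE /= scale1r.
Qed.

End Tau.
End Spinors.

Theorem theorem4p3 (R : realType) (mu : R) (eps : R[i]) (J : 'M[R[i]]_2)
    (heps : is_sign eps) (hJ : conj_mx J *m J = eps%:M) :
  ((exists c0 c1 c2 c3 c4 : R[i],
      generic_clifford c0 c1 c2 c3 c4 /\
      exists (e' : R[i]) (sS : 'I_2 -> 'I_2 -> 'M[R[i]]_2),
        is_sign e' /\
        local_conditions mu (clifford c0 c1 c2 c3 c4) J e' sS)
   <-> mu = 0)
  /\
  (forall c0 c1 c2 c3 c4 : R[i],
     generic_clifford c0 c1 c2 c3 c4 ->
     let Cl := clifford c0 c1 c2 c3 c4 in
     let K := comm_mx2 (Cl 0) (Cl 1) in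
     forall e' : R[i], is_sign e' ->
     [/\ forall sS : 'I_2 -> 'I_2 -> 'M[R[i]]_2,
           local_conditions mu Cl J e' sS <->
           mu = 0 /\
           exists zeta : 'M[R[i]]_2,
             [/\ zeta \in unitmx,
                 forall i j : 'I_2, sS i j = braiding_of K zeta i j,
                 clifford_reality Cl J e' zeta &
                 conj_mx zeta *m zeta
                 = (- ((\det K) ^+ 2 * \det zeta)^-1)%:M],
         mu = 0 -> forall zeta : 'M[R[i]]_2,
           zeta \in unitmx -> conj_mx zeta *m zeta = 1%:M ->
           (local_conditions mu Cl J e' (braiding_of K zeta) <->
            \det zeta = - ((\det K) ^+ 2)^-1 /\ clifford_reality Cl J e' zeta) &
         forall sS : 'I_2 -> 'I_2 -> 'M[R[i]]_2,
           local_conditions mu Cl J e' sS ->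
           forall (gamma : 'M[R[i]]_2) (e'' : R[i]), is_sign e'' ->
           (gamma_conditions Cl J e'' sS gamma <->
            (exists r : R[i], r ^+ 2 = - \det K /\ gamma = r^-1 *: K) /\
            conj_mx gamma = e'' *: (J *m gamma *m invmx J))]).
Proof.
split.
  split=> [[c0 [c1 [c2 [c3 [c4 [[c20 c40 unitK] [e' [sS [he' loc]]]]]]]]]|->].
    have sqrCl i := clifford_sqr R c0 c1 c2 c3 c4 i c20 c40.
    by have [] := local_conditions_reality _ _ _ heps hJ _ _ _ sqrCl unitK he'
      _ _ loc.
  have [c0 [c1 [c2 [c3 [c4 [gen [sS loc]]]]]]] :=
    exists_local_solution _ _ _ heps hJ.
  exists c0, c1, c2, c3, c4; split=> //.
  by exists 1, sS; split=> //; left.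
move=> c0 c1 c2 c3 c4 [c20 c40 unitK] Cl K e' he'.
have sqrCl i : Cl i *m Cl i = c0%:M by apply: clifford_sqr.
have detK : \det K != 0 by rewrite -unitfE -unitmxE.
have solution (zeta : 'M[R[i]]_2) (sS : 'I_2 -> 'I_2 -> 'M[R[i]]_2) :
    (forall k j, sS k j = zeta k j *: K) ->
    clifford_reality Cl J e' zeta -> local_conditions 0 Cl J e' sS.
  move=> sSE /(clifford_realityE _ _ _ heps hJ).
  exact: local_conditions_of_reality _ _ _ heps hJ _ _ _ sqrCl unitK he' _ _
    sSE.
have solved mu' sS : local_conditions mu' Cl J e' sS -> mu' = 0 /\
    exists zeta : 'M[R[i]]_2, [/\ zeta \in unitmx,
      forall i j, sS i j = zeta i j *: K, clifford_reality Cl J e' zeta &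
      conj_mx zeta *m zeta = (- ((\det K) ^+ 2 * \det zeta)^-1)%:M].
  move=> /(local_conditions_reality _ _ _ heps hJ _ _ _ sqrCl unitK he').
  case=> -> [zeta [sSE real_Cl]]; split=> //; exists zeta; split=> //.
  - exact: zeta_unit _ _ _ heps hJ _ _ _ sqrCl unitK he' _ real_Cl.
  - exact/(clifford_realityE _ _ _ heps hJ).
  - exact: conj_zeta_mul_zeta _ _ _ heps hJ _ _ _ sqrCl unitK he' _ real_Cl.
split.
- move=> sS; split=> [/solved //|[-> [zeta [_ sSE real_Cl _]]]].
  exact: solution _ _ sSE real_Cl.
- move=> mu0 zeta zeta_unit zeta1; rewrite mu0.
  have dz : \det zeta != 0 by rewrite -unitfE -unitmxE.
  split=> [/solved[_ [zeta' [_ zetaE real_Cl zz]]]|[_ real_Cl]]; last first.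
    exact: (solution zeta _ (fun _ _ => erefl)) real_Cl.
  have eq_zeta : zeta' = zeta.
    apply/matrixP=> i j; apply/eqP; rewrite -subr_eq0.
    have /eqP := zetaE i j; rewrite -subr_eq0 -scalerBl scaler_eq0.
    have K0 : K != 0 by apply: contra_neq detK => ->; rewrite det0.
    by rewrite (negPf K0) orbF -opprB oppr_eq0.
  subst zeta'; split=> //.
  have := congr1 (fun X : 'M_2 => X 0 0) zz; rewrite zeta1 !mxE !mulr1n => e1.
  rewrite -[LHS]mulr1 e1; field; by rewrite dz detK.
- move=> sS /solved[_ [zeta [_ sSE _ _]]] gamma e'' _.
  exact: gamma_conditionsE _ _ _ heps hJ _ _ sqrCl unitK _ _ _ _ sSE.
Qed.
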